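(* Let $\underline{C}$ be a $G$-coalgebra. The following assertions are equivalent: (1) $\underline{C}$ is a strong $G$-coalgebra; (2) for all $\alpha\in G$, $\Delta_{\alpha,\alpha^{-1}}:C_e\to C_\alpha\otimes C_{\alpha^{-1}}$ is a monomorphism; (3) for all $\underline{M}\in\mathcal{M}^{G,\underline{C}}$ and all $\alpha,\beta\in G$, $\rho^{\underline{M}}_{\alpha,\beta}$ is a monomorphism.
   Context: $k$ is a field, $\otimes=\otimes_k$, $G$ is a group with identity $e$; the identity map of an object $X$ is denoted $X$. A $G$-coalgebra (group coalgebra) $\underline{C}=(C_\alpha)_{\alpha\in G}$ is a family of $k$-vector spaces with $k$-linear maps $\Delta_{\alpha,\beta}:C_{\alpha\beta}\to C_\alpha\otimes C_\beta$ ($\alpha,\beta\in G$) and $\varepsilon:C_e\to k$ such that $(\Delta_{\alpha,\beta}\otimes C_\gamma)\circ\Delta_{\alpha\beta,\gamma}=(C_\alpha\otimes\Delta_{\beta,\gamma})\circ\Delta_{\alpha,\beta\gamma}$ and $(C_\alpha\otimes\varepsilon)\circ\Delta_{\alpha,e}=C_\alpha=(\varepsilon\otimes C_\alpha)\circ\Delta_{e,\alpha}$. $\underline{C}$ is called strong if $\Delta_{\alpha,\beta}:C_{\alpha\beta}\to C_\alpha\otimes C_\beta$ is a monomorphism for all $\alpha,\beta\in G$. A right $G$-$\underline{C}$-comodule is a family $\underline{M}=(M_\alpha)_{\alpha\in G}$ of $k$-vector spaces with $k$-linear maps $\rho_{\alpha,\beta}=\rho^{\underline{M}}_{\alpha,\beta}:M_{\alpha\beta}\to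 M_\alpha\otimes C_\beta$ such that $(M_\alpha\otimes\varepsilon)\circ\rho_{\alpha,e}=M_\alpha$ and $(\rho_{\alpha,\beta}\otimes C_\gamma)\circ\rho_{\alpha\beta,\gamma}=(M_\alpha\otimes\Delta_{\beta,\gamma})\circ\rho_{\alpha,\beta\gamma}$. $\mathcal{M}^{G,\underline{C}}$ is the category of right $G$-$\underline{C}$-comodules. *)

(* Defs.v *)
From HB Require Import structures.
From mathcomp Require Import all_boot all_order all_algebra.
From mathcomp Require Import finmap monalg.
From mathcomp Require Import boolp.

Set Implicit Arguments.
Unset Strict Implicit.
Unset Printing Implicit Defensive.

Import GRing.Theory.
Local Open Scope fset_scope.
Local Open Scope ring_scope.
Local Open Scope quotient_scope.

(* {malg K[T]} is used only as the free vector space on the set T, with basis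
   vectors << 1 *g p >>; its multiplication plays no role. *)
Section FreeModule.
Variables (K : fieldType) (T : choiceType) (U : lmodType K) (f : T -> U).

Definition freelin (g : {malg K[T]}) : U :=
  \sum_(p <- msupp g) g@_p *: f p.

Lemma freelinEw (g : {malg K[T]}) (d : {fset T}) :
  msupp g `<=` d -> freelin g = \sum_(p <- d) g@_p *: f p.
Proof.
move=> le_gd; rewrite /freelin (big_fset_incl _ le_gd) //= => p _.
by move=> /mcoeff_outdom ->; rewrite scale0r.
Qed.

Lemma freelin_is_linear : linear freelin.
Proof.
move=> a g h; pose d := msupp g `|` msupp h.
have le_g : msupp g `<=` d by apply: fsubsetUl.
have le_h : msupp h `<=` d by apply: fsubsetUr.
have le_gh : msupp (a *: g + h) `<=` d.
  apply: (fsubset_trans (msuppD_le _ _)); apply: fsetSU; exact: msuppZ_le.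
rewrite (freelinEw le_g) (freelinEw le_h) (freelinEw le_gh).
rewrite scaler_sumr -big_split /=; apply: eq_bigr => p _.
by rewrite mcoeffD mcoeffZ scalerDl scalerA.
Qed.

HB.instance Definition _ :=
  GRing.isLinear.Build K {malg K[T]} U *:%R freelin freelin_is_linear.

Lemma freelinU p : freelin << 1 *g p >> = f p.
Proof. by rewrite (freelinEw msuppU_le) big_seq_fset1 mcoeffUU scale1r. Qed.

End FreeModule.

(* The tensor product over K of two possibly infinite-dimensional vector
   spaces: the free vector space on V * W modulo the span of the bilinearity
   relators. *)
Section TensorProduct.
Variables (K : fieldType) (V W : lmodType K).

Inductive tensor_relator : {malg K[(V * W)%type]} -> Prop :=
| tensor_relatorL (a : K) (v v' : V) (w : W) : tensor_relator
    (<< 1 *g (a *: v + v', w) >>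
      - (a *: << 1 *g (v, w) >> + << 1 *g (v', w) >>))
| tensor_relatorR (a : K) (v : V) (w w' : W) : tensor_relator
    (<< 1 *g (v, a *: w + w') >>
      - (a *: << 1 *g (v, w) >> + << 1 *g (v, w') >>)).

Inductive tensor_relations : {malg K[(V * W)%type]} -> Prop :=
| tensor_relations0 : tensor_relations 0
| tensor_relations_cons (a : K) r x :
    tensor_relator r -> tensor_relations x -> tensor_relations (a *: r + x).

Lemma tensor_relationsP a x y :
  tensor_relations x -> tensor_relations y -> tensor_relations (a *: x + y).
Proof.
move=> + ry; elim=> [|b r z rr _ IH]; first by rewrite scaler0 add0r.
rewrite scalerDr scalerA -addrA; exact: tensor_relations_cons.
Qed.

Definition tensor_ker : {pred {malg K[(V * W)%type]}} :=
  fun x => `[< tensor_relations x >].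

Lemma tensor_ker_zmod_closed : zmod_closed tensor_ker.
Proof.
split=> [|x y /asboolP rx /asboolP ry]; apply/asboolP.
  exact: tensor_relations0.
by rewrite addrC -scaleN1r; apply: tensor_relationsP.
Qed.

HB.instance Definition _ :=
  GRing.isZmodClosed.Build {malg K[(V * W)%type]} tensor_ker tensor_ker_zmod_closed.

Definition tensor := Quotient.quot tensor_ker.
HB.instance Definition _ := GRing.Zmodule.on tensor.
HB.instance Definition _ := EqQuotient.on tensor.

Definition tensor_pi (x : {malg K[(V * W)%type]}) : tensor := \pi_tensor x.

Lemma tensor_piP x y : reflect (tensor_pi x = tensor_pi y) (x - y \in tensor_ker).
Proof. rewrite Quotient.idealrBE; exact: eqP. Qed.

Lemma tensor_piB x y : tensor_pi (x - y) = tensor_pi x - tensor_pi y.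
Proof. by rewrite /tensor_pi raddfB. Qed.

Lemma tensor_piD x y : tensor_pi (x + y) = tensor_pi x + tensor_pi y.
Proof. by rewrite /tensor_pi raddfD. Qed.

Lemma tensor_kerZ a x : x \in tensor_ker -> a *: x \in tensor_ker.
Proof.
move=> /asboolP rx; apply/asboolP; rewrite -[_ *: _]addr0.
by apply: tensor_relationsP => //; exact: tensor_relations0.
Qed.

Definition tensor_scale (a : K) (t : tensor) : tensor :=
  tensor_pi (a *: repr t).

Lemma tensor_piZ a x : tensor_scale a (tensor_pi x) = tensor_pi (a *: x).
Proof.
apply/tensor_piP; rewrite -scalerBr; apply/tensor_kerZ/tensor_piP.
exact: reprK.
Qed.

Lemma tensor_pi_surj (t : tensor) : {x | t = tensor_pi x}.
Proof. by exists (repr t); rewrite /tensor_pi reprK. Qed.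

Lemma tensor_scaleA a b t :
  tensor_scale a (tensor_scale b t) = tensor_scale (a * b) t.
Proof. by have [x ->] := tensor_pi_surj t; rewrite !tensor_piZ scalerA. Qed.

Lemma tensor_scale1 : left_id 1 tensor_scale.
Proof. by move=> t; have [x ->] := tensor_pi_surj t; rewrite tensor_piZ scale1r. Qed.

Lemma tensor_scaleDr : right_distributive tensor_scale +%R.
Proof.
move=> a s t; have [x ->] := tensor_pi_surj s; have [y ->] := tensor_pi_surj t.
by rewrite -tensor_piD !tensor_piZ scalerDr tensor_piD.
Qed.

Lemma tensor_scaleDl t : {morph tensor_scale^~ t : a b / a + b}.
Proof.
move=> a b; have [x ->] := tensor_pi_surj t.
by rewrite !tensor_piZ scalerDl tensor_piD.
Qed.

HB.instance Definition _ := GRing.Zmodule_isLmodule.Build K tensor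
  tensor_scaleA tensor_scale1 tensor_scaleDr tensor_scaleDl.

Lemma tensor_pi_is_linear : linear tensor_pi.
Proof. by move=> a x y; rewrite tensor_piD -tensor_piZ. Qed.

HB.instance Definition _ := GRing.isLinear.Build K {malg K[(V * W)%type]} tensor *:%R
  tensor_pi tensor_pi_is_linear.

Definition tens (v : V) (w : W) : tensor := tensor_pi << 1 *g (v, w) >>.

Lemma tensor_pi_relator r : tensor_relator r -> tensor_pi r = 0.
Proof.
move=> rr; rewrite -(linear0 tensor_pi); apply/tensor_piP; rewrite subr0.
apply/asboolP; rewrite -[r]addr0 -[r]scale1r.
by apply: tensor_relations_cons => //; exact: tensor_relations0.
Qed.

Lemma tens_linearl w : linear (tens^~ w).
Proof.
move=> a v v'; apply/eqP; rewrite -subr_eq0; apply/eqP.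
have := tensor_pi_relator (tensor_relatorL a v v' w).
by rewrite tensor_piB tensor_piD -tensor_piZ.
Qed.

Lemma tens_linearr v : linear (tens v).
Proof.
move=> a w w'; apply/eqP; rewrite -subr_eq0; apply/eqP.
have := tensor_pi_relator (tensor_relatorR a v w w').
by rewrite tensor_piB tensor_piD -tensor_piZ.
Qed.

Lemma tens_is_bilinear : bilinear_for *:%R *:%R tens.
Proof. by split; [exact: tens_linearl | exact: tens_linearr]. Qed.

HB.instance Definition _ := bilinear_isBilinear.Build K V W tensor *:%R *:%R
  tens tens_is_bilinear.

Lemma tensorE (t : tensor) : exists s : seq (V * W),
  t = \sum_(p <- s) tens p.1 p.2.
Proof.
have [x ->] := tensor_pi_surj t; rewrite (monalgE x) linear_sum /=.
exists [seq (x@_p *: p.1, p.2) | p <- msupp x]; rewrite big_map.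
apply: eq_bigr => -[v w] _ /=; rewrite linearZl_LR /= /tens -linearZ /=.
by congr tensor_pi; apply/malgP => q; rewrite mcoeffZ !mcoeffU mulr_natr.
Qed.

Section Lift.
Variables (U : lmodType K) (f : {bilinear V -> W -> U}).

Let F : {linear {malg K[(V * W)%type]} -> U} :=
  freelin (fun p : V * W => f p.1 p.2).

Lemma tensor_lift_subproof x : x \in tensor_ker -> F x = 0.
Proof.
move=> /asboolP; elim=> [|a r y rr _ Fy]; first exact: linear0.
rewrite linearP Fy addr0; case: rr => [b v v' w|b v w w'];
  rewrite linearB linearP /= !freelinU /= ?linearPl ?linearPr subrr;
  exact: scaler0.
Qed.

Definition tensor_lift (t : tensor) : U := F (repr t).

Lemma tensor_lift_pi x : tensor_lift (tensor_pi x) = F x.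
Proof.
apply/eqP; rewrite -subr_eq0 /tensor_lift -linearB.
apply/eqP/tensor_lift_subproof/tensor_piP; exact: reprK.
Qed.

Lemma tensor_lift_is_linear : linear tensor_lift.
Proof.
move=> a s t; have [x ->] := tensor_pi_surj s; have [y ->] := tensor_pi_surj t.
by rewrite -linearP !tensor_lift_pi linearP.
Qed.

HB.instance Definition _ := GRing.isLinear.Build K tensor U *:%R
  tensor_lift tensor_lift_is_linear.

Lemma tensor_liftE v w : tensor_lift (tens v w) = f v w.
Proof. by rewrite tensor_lift_pi /= freelinU. Qed.

End Lift.

Lemma tensor_ext (U : lmodType K) (f g : {linear tensor -> U}) :
  (forall v w, f (tens v w) = g (tens v w)) -> f =1 g.
Proof.
move=> fg t; have [s ->] := tensorE t; rewrite !linear_sum /=.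
by apply: eq_bigr => p _; apply: fg.
Qed.

End TensorProduct.

Notation "V ⊗ W" := (tensor V W) (at level 40, left associativity) : type_scope.

Section TensorMap.
Variables (K : fieldType) (V V' W W' : lmodType K).
Variables (f : {linear V -> V'}) (g : {linear W -> W'}).

Definition tens2 (v : V) (w : W) : V' ⊗ W' := tens (f v) (g w).

Lemma tens2_is_bilinear : bilinear_for *:%R *:%R tens2.
Proof.
split=> [w a v v' | v a w w'] /=; rewrite /tens2 linearP.
  by rewrite linearPl.
by rewrite linearPr.
Qed.

HB.instance Definition _ := bilinear_isBilinear.Build K V W (V' ⊗ W') *:%R *:%R
  tens2 tens2_is_bilinear.

Definition tensor_map : V ⊗ W -> V' ⊗ W' := tensor_lift tens2.
HB.instance Definition _ := GRing.Linear.on tensor_map.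

Lemma tensor_mapE v w : tensor_map (tens v w) = tens (f v) (g w).
Proof. exact: tensor_liftE. Qed.

Lemma tensor_map_sum (s : seq (V * W)) :
  tensor_map (\sum_(p <- s) tens p.1 p.2) =
  \sum_(p <- s) tens (f p.1) (g p.2).
Proof.
rewrite linear_sum; apply: eq_bigr => p _; exact: tensor_mapE.
Qed.

End TensorMap.

Section Associator.
Variables (K : fieldType) (V W U : lmodType K).

Definition assoc_bil (t : V ⊗ W) (u : U) : V ⊗ (W ⊗ U) :=
  tensor_map idfun (applyr (@tens K W U) u) t.

Lemma assoc_bil_linearl u : linear (assoc_bil^~ u).
Proof. by move=> a s t; rewrite /assoc_bil linearP. Qed.

Lemma assoc_bil_linearr t : linear (assoc_bil t).
Proof.
move=> a u u'; have [s ->] := tensorE t.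
rewrite /assoc_bil !tensor_map_sum scaler_sumr -big_split.
apply: eq_bigr => p _; rewrite /= /applyr.
rewrite (linearPr (@tens K W U)).
exact: (linearPr (@tens K V (W ⊗ U))).
Qed.

Lemma assoc_bil_is_bilinear : bilinear_for *:%R *:%R assoc_bil.
Proof. by split; [exact: assoc_bil_linearl | exact: assoc_bil_linearr]. Qed.

HB.instance Definition _ := bilinear_isBilinear.Build K (V ⊗ W) U (V ⊗ (W ⊗ U))
  *:%R *:%R assoc_bil assoc_bil_is_bilinear.

Definition tensorA : (V ⊗ W) ⊗ U -> V ⊗ (W ⊗ U) := tensor_lift assoc_bil.
HB.instance Definition _ := GRing.Linear.on tensorA.

Lemma tensorAE v w u : tensorA (tens (tens v w) u) = tens v (tens w u).
Proof. rewrite [LHS]tensor_liftE; exact: tensor_mapE. Qed.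

End Associator.

Section Unitors.
Variables (K : fieldType) (V : lmodType K).

Definition unitr_bil (v : V) (a : K^o) : V := a *: v.

Lemma unitr_bil_is_bilinear : bilinear_for *:%R *:%R unitr_bil.
Proof.
split=> [a b v v' | v b a a'] /=; rewrite /unitr_bil.
  by rewrite scalerDr !scalerA mulrC.
by rewrite scalerDl scalerA.
Qed.

HB.instance Definition _ := bilinear_isBilinear.Build K V K^o V *:%R *:%R
  unitr_bil unitr_bil_is_bilinear.

Definition unitl_bil (a : K^o) (v : V) : V := a *: v.

Lemma unitl_bil_is_bilinear : bilinear_for *:%R *:%R unitl_bil.
Proof.
split=> [v b a a' | a b v v'] /=; rewrite /unitl_bil.
  by rewrite scalerDl scalerA.
by rewrite scalerDr !scalerA mulrC.
Qed.

HB.instance Definition _ := bilinear_isBilinear.Build K K^o V V *:%R *:%R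
  unitl_bil unitl_bil_is_bilinear.

Definition tensor_unitr : V ⊗ K^o -> V := tensor_lift unitr_bil.
HB.instance Definition _ := GRing.Linear.on tensor_unitr.
Definition tensor_unitl : K^o ⊗ V -> V := tensor_lift unitl_bil.
HB.instance Definition _ := GRing.Linear.on tensor_unitl.

Lemma tensor_unitrE v (a : K^o) : tensor_unitr (tens v a) = a *: v.
Proof. exact: tensor_liftE. Qed.

Lemma tensor_unitlE v (a : K^o) : tensor_unitl (tens a v) = a *: v.
Proof. exact: tensor_liftE. Qed.

End Unitors.

Section Monomorphism.
Variables (K : fieldType) (V W : lmodType K).

(* Left cancellability in the category of all K-vector spaces. *)
Definition monomorphism (f : {linear V -> W}) : Prop :=
  forall (U : lmodType K) (g h : {linear U -> V}), f \o g =1 f \o h -> g =1 h.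

Definition line (v : V) (a : K^o) : V := a *: v.

Lemma line_is_linear v : linear (line v).
Proof. by move=> a b c; rewrite /line scalerDl scalerA. Qed.

HB.instance Definition _ v :=
  GRing.isLinear.Build K K^o V *:%R (line v) (line_is_linear v).

Lemma monomorphismP (f : {linear V -> W}) : monomorphism f <-> injective f.
Proof.
split=> [mono_f x y fxy | inj_f U g h fgh u]; last exact/inj_f/fgh.
have fl : f \o line x =1 f \o line y by move=> a; rewrite /= !linearZ fxy.
by have := mono_f _ _ _ fl 1; rewrite /= /line !scale1r.
Qed.

End Monomorphism.

Section Transport.
Variables (K : fieldType) (I : Type) (F : I -> lmodType K) (i j : I) (e : i = j).

Definition transport : F i -> F j := eq_rect i (fun k => F i -> F k) id j e.

Lemma transport_is_linear : linear transport.
Proof. by rewrite /transport; case: j / e. Qed.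

HB.instance Definition _ :=
  GRing.isLinear.Build K (F i) (F j) *:%R transport transport_is_linear.

End Transport.
Arguments transport {K I} F {i j} e.

(* K is viewed as the vector space K^o, and the identifications
   (V ⊗ W) ⊗ U = V ⊗ (W ⊗ U) and V ⊗ K = V = K ⊗ V are the maps tensorA,
   tensor_unitr and tensor_unitl. Equalities of indices such as
   (a * b) * c = a * (b * c) are only propositional, hence the transports. *)
Record gcoalgebra (K : fieldType) (G : groupType) := GCoalgebra {
  gcoalg :> G -> lmodType K;
  comult : forall a b : G, {linear gcoalg (a * b)%g -> gcoalg a ⊗ gcoalg b};
  counit : {linear gcoalg 1%g -> K^o};
  comultA : forall (a b c : G) (x : gcoalg (a * b * c)%g),
    tensorA (tensor_map (comult a b) idfun (comult (a * b)%g c x)) =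
    tensor_map idfun (comult b c)
      (comult a (b * c)%g (transport gcoalg (esym (mulgA a b c)) x));
  comult1r : forall (a : G) (x : gcoalg (a * 1)%g),
    tensor_unitr (tensor_map idfun counit (comult a 1%g x)) =
    transport gcoalg (mulg1 a) x;
  comult1l : forall (a : G) (x : gcoalg (1 * a)%g),
    tensor_unitl (tensor_map counit idfun (comult 1%g a x)) =
    transport gcoalg (mul1g a) x
}.

Record gcomodule (K : fieldType) (G : groupType) (C : gcoalgebra K G) :=
GComodule {
  gcomod :> G -> lmodType K;
  coact : forall a b : G, {linear gcomod (a * b)%g -> gcomod a ⊗ C b};
  coact1 : forall (a : G) (x : gcomod (a * 1)%g),
    tensor_unitr (tensor_map idfun (counit C) (coact a 1%g x)) =
    transport gcomod (mulg1 a) x;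
  coactA : forall (a b c : G) (x : gcomod (a * b * c)%g),
    tensorA (tensor_map (coact a b) idfun (coact (a * b)%g c x)) =
    tensor_map idfun (comult C b c)
      (coact a (b * c)%g (transport gcomod (esym (mulgA a b c)) x))
}.

Definition strong (K : fieldType) (G : groupType) (C : gcoalgebra K G) : Prop :=
  forall a b : G, monomorphism (comult C a b).

Definition comultV (K : fieldType) (G : groupType) (C : gcoalgebra K G) (a : G)
    : {linear C 1%g -> C a ⊗ C a^-1%g} :=
  comult C a a^-1%g \o transport C (esym (mulgV a)).

(* Main.v *)
Require Import Defs.
From HB Require Import structures.
From mathcomp Require Import all_boot all_order all_algebra.
From mathcomp Require Import boolp classical_sets.

Set Implicit Arguments.
Unset Strict Implicit.
Unset Printing Implicit Defensive.

Import GRing.Theory.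
Local Open Scope classical_set_scope.
Local Open Scope ring_scope.

(** Only the passage from (2) to (3) needs an argument: (1) contains (2) up to
    the identification of [C (a * a^-1)] with [C 1], and (3) gives (1) because
    [C] is a comodule over itself. Assume (2) and [coact M a b x = 0]. Read
    [x] in [M (a * b * b^-1 * b)], as the indices [a] and [a * b * b^-1]
    agree. By coassociativity the map [id ⊗ comult b^-1 b] kills
    [coact M (a * b) (b^-1 * b) x], because its value there is obtained from
    [coact M a b x] by applying [coact M (a * b) b^-1 ⊗ id]. By (2) the map
    [comult b^-1 b] is injective, hence so is [id ⊗ comult b^-1 b] by
    exactness of the tensor product over a field ([tensor_map_injr]). Thus
    [coact M (a * b) 1 x = 0], and the counit axiom returns [x = 0].

    Exactness holds because an injective linear map of vector spaces, of any
    dimension, has a linear retraction ([linear_retraction]), a consequence of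
    Zorn's lemma. *)

Section Retraction.
Variables (K : fieldType) (V W : lmodType K) (f : {linear V -> W}).
Hypothesis f_inj : injective f.

(** The empty set is allowed, so that the union of the empty chain qualifies in
    Zorn's lemma. *)
Let disjoint_from_image (N : set W) :=
  (forall a x y, N x -> N y -> N (a *: x + y)) /\ (forall v, N (f v) -> v = 0).

(** A subspace [N] maximal among those meeting the image of [f] trivially is a
    complement of this image: if [w] were not in the sum, then [N + K w]
    would be larger and would still meet the image trivially. *)
Lemma image_complement : exists N : set W,
  [/\ N 0, disjoint_from_image N & forall w, exists v, N (w - f v)].
Proof.
have [|N [[Nlin Nf] Nmax]] := @Zorn_bigcup W disjoint_from_image.
  move=> F FP Ftot; split=> [a x y [X FX Xx] [Y FY Yy]|v [X FX Xv]]; last first.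
    by have [_] := FP _ FX; apply.
  have [XY|YX] := Ftot _ _ FX FY.
    by exists Y => //; apply: (FP _ FY).1 => //; apply: XY.
  by exists X => //; apply: (FP _ FX).1 => //; apply: YX.
have N0 : N 0.
  apply: contrapT => N0; apply: (Nmax [set 0]); last first.
    split=> [a x y -> ->|v]; first by rewrite scaler0 addr0.
    by move=> /= fv0; apply: f_inj; rewrite fv0 linear0.
  split; last by move=> /(_ 0 erefl).
  by move=> x Nx; case: N0; rewrite -(addNr x) -scaleN1r; apply: Nlin.
have NZ a x : N x -> N (a *: x) by move=> Nx; rewrite -[_ *: _]addr0; apply: Nlin.
exists N; split=> // w; apply: contrapT => Nw.
pose B := [set z | exists c n, N n /\ z = c *: w + n].
apply: (Nmax B).
  split; first by move=> n Nn; exists 0, n; rewrite scale0r add0r.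
  move=> /(_ w) BN; apply: Nw; exists 0; rewrite linear0 subr0; apply: BN.
  by exists 1, 0; rewrite scale1r addr0.
(* If [f v = c *: w + n], then [c = 0], as otherwise [w] would decompose. *)
split=> [a x y [c [n [Nn ->]]] [d [m [Nm ->]]]|v [c [n [Nn fv]]]].
  exists (a * c + d), (a *: n + m); split; first exact: Nlin.
  by rewrite scalerDr scalerA scalerDl addrACA.
have [c0|c0] := eqVneq c 0.
  by apply: Nf; rewrite fv c0 scale0r add0r.
case: Nw; exists (c^-1 *: v); rewrite linearZ /= fv scalerDr scalerA.
by rewrite mulVf // scale1r opprD addrA subrr add0r -scalerN -scaleN1r; exact/NZ/NZ.
Qed.

Lemma linear_retraction : exists g : {linear W -> V}, cancel f g.
Proof.
have [N [N0 [Nlin Nf] /choice[g Ng]]] := image_complement.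
have g_unique w v : N (w - f v) -> g w = v.
  move=> Nv; apply/eqP; rewrite -subr_eq0; apply/eqP/Nf.
  suff -> : f (g w - v) = -1 *: (w - f (g w)) + (w - f v) by apply: Nlin.
  by rewrite scaleN1r opprB linearB /= addrA subrK.
have g_lin : linear g.
  move=> a x y; apply: g_unique; rewrite linearP opprD addrACA -scalerBr.
  exact: Nlin.
pose gM := GRing.isLinear.Build K W V *:%R g g_lin.
pose gL : {linear W -> V} := HB.pack g gM.
by exists gL => v; apply: g_unique; rewrite subrr.
Qed.

End Retraction.

(** A retraction [g] of [f] yields the retraction [id ⊗ g] of [id ⊗ f]. *)
Lemma tensor_map_injr (K : fieldType) (U V W : lmodType K)
    (f : {linear V -> W}) :
  injective f -> injective (@tensor_map K U U V W idfun f).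
Proof.
move=> /linear_retraction[g fK]; apply: (can_inj (g := tensor_map idfun g)).
apply: (@tensor_ext _ _ _ _ (tensor_map idfun g \o tensor_map idfun f) idfun).
by move=> u v /=; rewrite !tensor_mapE /= fK.
Qed.

Lemma transport_inj (K : fieldType) (I : Type) (F : I -> lmodType K) (i j : I)
  (e : i = j) : injective (transport F e).
Proof. by case: j / e. Qed.

Lemma transport_eq0 (K : fieldType) (I : Type) (F : I -> lmodType K) (i j : I)
  (e : i = j) x : (transport F e x == 0) = (x == 0).
Proof. by case: j / e. Qed.

Section Comodules.
Variables (K : fieldType) (G : groupType) (C : gcoalgebra K G).

Definition regular_comodule : gcomodule C :=
  GComodule (@comult1r _ _ C) (@comultA _ _ C).

Lemma coact_transport0 (M : gcomodule C) (a a' b b' : G)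
    (e : (a * b = a' * b')%g) x :
  a = a' -> b = b' -> coact M a b x = 0 -> coact M a' b' (transport M e x) = 0.
Proof.
move=> aE bE; case: a' / aE e => e; case: b' / bE e => e.
by rewrite (eq_irrelevance e erefl).
Qed.

Lemma comult_inj_of_comultV (a b : G) :
  injective (comultV C a) -> b = a^-1%g -> injective (comult C a b).
Proof.
move=> inj_a ->.
have tK : cancel (transport C (mulgV a)) (transport C (esym (mulgV a))).
  by case: _ / (mulgV a).
move=> x y xy; apply: (@transport_inj _ _ C _ _ (mulgV a)).
by apply: inj_a; rewrite /= !tK.
Qed.

(** Coassociativity at the indices [a * b], [b^-1], [b] recovers [coact M a b]
    on its left side and [coact M (a * b) 1], injective by the counit axiom, on
    its right side. *)
Lemma coact_inj (M : gcomodule C) (a b : G) :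
  injective (comult C b^-1%g b) -> injective (coact M a b).
Proof.
move=> /tensor_map_injr comult_inj; apply: raddf_inj => x x0.
have e : (a * b = a * b * b^-1 * b)%g by rewrite mulgK.
(* The left side of coassociativity is the image of [coact M a b x = 0]. *)
have := coactA (transport M e x).
rewrite (coact_transport0 e _ _ x0) ?mulgK // !linear0.
rewrite -(linear0 (tensor_map idfun (comult C b^-1%g b))) => /comult_inj/esym.
(* [C (b^-1 * b)] is [C 1], so the counit axiom applies to [y]. *)
have e1 : (a * b * (b^-1 * b) = a * b * 1)%g by rewrite mulVg.
set y := transport M (esym _) _ => y0.
have := coact1 (transport M e1 y).
rewrite (coact_transport0 e1 erefl (mulVg b) y0) !linear0.
by move/esym/eqP; rewrite transport_eq0 transport_eq0 /y !transport_eq0 => /eqP.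
Qed.

End Comodules.

Theorem proposition1p3 (K : fieldType) (G : groupType) (C : gcoalgebra K G) :
  [<-> strong C;
       forall a : G, monomorphism (comultV C a);
       forall (M : gcomodule C) (a b : G), monomorphism (coact M a b)].
Proof.
tfae=> [strongC a|monoV M a b|mono_coact a b].
- apply/monomorphismP; apply: inj_comp; last exact: transport_inj.
  exact/monomorphismP.
- apply/monomorphismP/coact_inj/comult_inj_of_comultV; last by rewrite invgK.
  exact/monomorphismP.
- exact: (mono_coact (regular_comodule C)).
Qed.
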